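(* Let $\Gamma$ and $\Delta$ be amenably measure equivalent countable discrete groups, let $(\Sigma,\sigma)$, $X$, $Y$, $\mu=\sigma|_X$ and the Borel cocycle $\alpha:\Gamma\times X\to\Delta$ be as described in the context. Then $\alpha$ is a proper cocycle from $\Gamma\times X$ to $\Delta$ (properness being understood with respect to a probability measure on $X$ equivalent to $\mu$). More precisely: (a) Let $1\in K\subset\Gamma$ be finite, let $A\subset X$ be a Borel set with finite measure and let $\varepsilon>0$. Then there exist a Borel set $A_{\varepsilon,K}\subset A$ and a finite set $F\subset\Delta$ such that $\sigma(A\smallsetminus A_{\varepsilon,K})<\varepsilon$ and $$\bigcup_{\gamma\in K}\gamma A_{\varepsilon,K}\subset\bigsqcup_{\delta\in F}X\delta.$$ In particular $\alpha(K\times A_{\varepsilon,K})$ is a finite set and $\alpha$ satisfies condition (i) of the definition of proper cocycle. (b) Let $1\in F\subset\Delta$ be a finite set and let $\mathcal{A}_F$ be the set of Borel subsets $A$ of $X$ with finite measure for which there exists a finite set $K=K(A,F)\subset\Gamma$ such that $$\bigsqcup_{\delta\in F}A\delta\subset\bigsqcup_{\gamma\in K}\gamma Y.$$ Then the elements of $\mathcal{A}_F$ have the following properties: (b1) For every Borel set $A\subset X$ with finite measure and for every $\varepsilon>0$, there exists $A_\varepsilon\in\mathcal{A}_F$ such that $A_\varepsilon\subset A$ and $\mu(A\smallsetminus A_\varepsilon)<\varepsilon$. (b2) Let $A\in\mathcal{A}_F$ and let $K$ be a finite subset of $\Gamma$ such that $\bigsqcup_{\delta\in F}A\delta\subset\bigsqcup_{\gamma\in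 K}\gamma Y$. For $\gamma\in\Gamma$, set $X_A(\gamma)=\{x\in A\cap\gamma^{-1}\cdot A:\alpha(\gamma,x)\in F\}$. Then $X_A(\gamma)=\emptyset$ for every $\gamma\notin KK^{-1}$. In particular, $\alpha$ satisfies condition (ii) of the definition of proper cocycle.
   Context: Amenable pair. If a group $G$ acts in a measure class preserving way on a standard measure space $(X,\mu)$, then $(G,X)$ is an amenable pair if $L^\infty(X,\mu)$ has a $G$-invariant state. Setting. $\Gamma$ and $\Delta$ are countable discrete groups that are amenably measure equivalent: there are commuting, measure-preserving, free actions of $\Gamma$ (on the left) and $\Delta$ (on the right) on an infinite-measure ($\sigma$-finite) standard space $(\Sigma,\sigma)$ such that $(\Gamma,\Sigma/\Delta)$ and $(\Delta,\Gamma\backslash\Sigma)$ are amenable pairs. Such a space is fixed. Choose Borel cross-sections from $\Gamma\backslash\Sigma$ and $\Sigma/\Delta$ to $\Sigma$, with respective ranges $Y$ and $X$, so that $\Sigma=\bigsqcup_{\delta\in\Delta}X\delta=\bigsqcup_{\gamma\in\Gamma}\gamma Y$ (disjoint unions), and put $\mu=\sigma|_X$, $\nu=\sigma|_Y$ (not necessarily finite); the quotients $\Sigma/\Delta$ and $\Gamma\backslash\Sigma$ are identified with $(X,\mu)$ and $(Y,\nu)$. For $(\gamma,x)\in\Gamma\times X$, $\alpha(\gamma,x)\in\Delta$ is the unique element with $\gamma x\in X\alpha(\gamma,x)$. Then $\gamma\cdot x:=\gamma x\alpha(\gamma,x)^{-1}\in X$ defines an action of $\Gamma$ on $X$ (isomorphic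 to the action on $\Sigma/\Delta$), which preserves $\mu$, and $\alpha$ is a Borel cocycle: $\alpha(\gamma_1\gamma_2,x)=\alpha(\gamma_1,\gamma_2\cdot x)\alpha(\gamma_2,x)$ for all $x\in X$, $\gamma_1,\gamma_2\in\Gamma$. The expressions $\gamma x$, $\gamma A$, $A\delta$ refer to the actions on $\Sigma$; $\gamma\cdot x$, $\gamma^{-1}\cdot A$ refer to the action of $\Gamma$ on $X$. Proper cocycle. Let $G$ act in a measure class preserving way on a standard space $X$ with probability measure $m$ and let $\alpha:G\times X\to H$ be a Borel cocycle ($G,H$ locally compact second countable). For a Borel set $A\subset X$, a compact set $L\subset H$ and $g\in G$, put $X_A(g)=\{x\in A\cap g^{-1}A:\alpha(g,x)\in L\}$, and let $K(A,L)$ be the set of $g\in G$ with $m(X_A(g))>0$. The cocycle $\alpha$ is proper if: (i) for every Borel set $A\subset X$, every $\varepsilon>0$ and every compact set $K\subset G$, there exists a Borel set $A_{\varepsilon,K}\subset A$ such that $m(A\smallsetminus A_{\varepsilon,K})<\varepsilon$ and $\alpha(K\times A_{\varepsilon,K})$ is precompact; (ii) for every compact set $L\subset H$ and every $\varepsilon>0$, there exists a Borel set $A\subset X$ such that $m(X\smallsetminus A)\le\varepsilon$ and $K(A,L)$ is precompact. Properness does not depend on the choice of probability measure within its equivalence class. For discrete groups, compact and precompact sets are finite sets. *)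

(* Defs.v *)
From HB Require Import structures.
From mathcomp Require Import all_boot all_order all_algebra.
From mathcomp Require Import all_classical all_reals all_analysis.

Set Implicit Arguments.
Unset Strict Implicit.
Unset Printing Implicit Defensive.

Import Order.TTheory GRing.Theory Num.Theory.
Import numFieldNormedType.Exports.

Local Open Scope classical_set_scope.
Local Open Scope ring_scope.

(* All groups are countable and discrete, so compact and precompact subsets
   are the finite ones and every subset is Borel. *)

(* The sigma-algebra of [T] is the Borel sigma-algebra of a Polish topology. *)
Definition standard_borel (R : realType) (d : measure_display)
    (T : measurableType d) : Prop :=
  exists (M : completePseudoMetricType R) (f : T -> M),
    [/\ hausdorff_space M, @second_countable M, bijective f &
        forall A : set T, measurable A <-> <<s @open M >> (f @` A)].

(* Measurable types are pointed and subsets are not types, so a standard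
   measure space is given by a Borel subset [D] of a standard Borel space [T]
   and a measure on [T] vanishing off [D]; its Borel sets are the Borel sets of
   [T] contained in [D]. *)
Definition standard_measure_space (R : realType) (d : measure_display)
    (T : measurableType d) (D : set T) (m : set T -> \bar R) : Prop :=
  [/\ standard_borel R T, measurable D, m (~` D) = 0%E & sigma_finite setT m].

Definition is_left_action (G : groupType) (T : Type) (act : G -> T -> T) :
    Prop :=
  (forall x, act 1%g x = x) /\
  (forall g h x, act (g * h)%g x = act g (act h x)).

Definition is_right_action (G : groupType) (T : Type) (act : T -> G -> T) :
    Prop :=
  (forall x, act x 1%g = x) /\
  (forall g h x, act x (g * h)%g = act (act x g) h).

Definition free_translations (G : groupType) (T : Type) (tr : G -> T -> T) :
    Prop :=
  forall g x, tr g x = x -> g = 1%g.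

Definition measure_preserving (R : realType) (d : measure_display)
    (T : measurableType d) (m : set T -> \bar R) (G : groupType)
    (tr : G -> T -> T) : Prop :=
  forall g, measurable_fun setT (tr g) /\
    forall A, measurable A -> m (tr g @^-1` A) = m A.

(* Only the values of [act] on [D] matter. *)
Definition measure_class_preserving_action (R : realType)
    (d : measure_display) (T : measurableType d) (D : set T)
    (m : set T -> \bar R) (G : groupType) (act : G -> T -> T) : Prop :=
  [/\ forall g x, D x -> D (act g x),
      forall x, D x -> act 1%g x = x,
      forall g h x, D x -> act (g * h)%g x = act g (act h x),
      forall g, measurable_fun D (act g) &
      forall g A, measurable A -> A `<=` D ->
        (m (D `&` act g @^-1` A) = 0%E <-> m A = 0%E)].

(* Representatives of the elements of (real) L^oo; a positive functional on
   them, positivity being understood almost everywhere, is constant on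
   almost-everywhere classes. *)
Notation Linfty m := (LfunType m (leey 1%E)).

Definition is_state (R : realType) (d : measure_display)
    (T : measurableType d) (m : {measure set T -> \bar R})
    (phi : Linfty m -> R) : Prop :=
  (forall f : Linfty m, {ae m, forall x, 0 <= f x} -> 0 <= phi f) /\
  (forall f : Linfty m, {ae m, forall x, f x = 1} -> phi f = 1).

(* Since [m] vanishes off [D], L^oo(T, m) is L^oo(D, m). *)
Definition amenable_pair (R : realType) (d : measure_display)
    (T : measurableType d) (D : set T) (m : {measure set T -> \bar R})
    (G : groupType) (act : G -> T -> T) : Prop :=
  [/\ standard_measure_space D m,
      measure_class_preserving_action D m act &
      exists phi : {scalar Linfty m},
        is_state phi /\
        forall (g : G) (f h : Linfty m),
          {ae m, forall x, D x -> h x = f (act g x)} -> phi h = phi f].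

Definition borel_cocycle (d : measure_display) (T : measurableType d)
    (D : set T) (G H : groupType) (act : G -> T -> T) (alpha : G -> T -> H) :
    Prop :=
  (forall g (B : set H), measurable (D `&` alpha g @^-1` B)) /\
  (forall g h x, D x ->
     alpha (g * h)%g x = (alpha g (act h x) * alpha h x)%g).

Definition recurrence_set (T : Type) (G H : groupType) (act : G -> T -> T)
    (alpha : G -> T -> H) (A : set T) (L : set H) (g : G) : set T :=
  A `&` (act g^-1%g @` A) `&` alpha g @^-1` L.

Definition cocycle_values (T : Type) (G H : groupType) (alpha : G -> T -> H)
    (K : set G) (A : set T) : set H :=
  [set alpha g x | g in K & x in A].

Definition proper_i (R : realType) (d : measure_display)
    (T : measurableType d) (D : set T) (m : set T -> \bar R)
    (G H : groupType) (alpha : G -> T -> H) : Prop :=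
  forall (A : set T) (eps : R) (K : set G),
    measurable A -> A `<=` D -> 0 < eps -> finite_set K ->
    exists A' : set T,
      [/\ measurable A', A' `<=` A, (m (A `\` A') < eps%:E)%E &
          finite_set (cocycle_values alpha K A')].

Definition proper_ii (R : realType) (d : measure_display)
    (T : measurableType d) (D : set T) (m : set T -> \bar R)
    (G H : groupType) (act : G -> T -> T) (alpha : G -> T -> H) : Prop :=
  forall (L : set H) (eps : R),
    finite_set L -> 0 < eps ->
    exists A : set T,
      [/\ measurable A, A `<=` D, (m (D `\` A) <= eps%:E)%E &
          finite_set
            [set g | (0 < m (recurrence_set act alpha A L g))%E]].

Definition proper_cocycle (R : realType) (d : measure_display)
    (T : measurableType d) (D : set T) (m : probability T R)
    (G H : groupType) (act : G -> T -> T) (alpha : G -> T -> H) : Prop :=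
  [/\ standard_measure_space D m,
      measure_class_preserving_action D m act,
      borel_cocycle D act alpha,
      proper_i D m alpha &
      proper_ii D m act alpha].

(* For a free Borel action of a countable group, the Borel sets with this
   property are the ranges of the Borel cross-sections of the quotient. *)
Definition fundamental_domain (T : Type) (G : groupType) (tr : G -> T -> T)
    (D : set T) : Prop :=
  trivIset setT (fun g => tr g @` D) /\ \bigcup_g (tr g @` D) = setT.

(* The unique [g] with [w] in the translate [tr g @` D]. *)
Definition translate_index (T : Type) (G : groupType) (tr : G -> T -> T)
    (D : set T) (w : T) : G :=
  xget 1%g [set g | (tr g @` D) w].

Section Coupling.
Context (S : Type) (Gamma Delta : groupType).
Variables (la : Gamma -> S -> S) (ra : S -> Delta -> S).

Definition alpha_cocycle (X : set S) (g : Gamma) (x : S) : Delta :=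
  translate_index (fun e w => ra w e) X (la g x).

Definition X_action (X : set S) (g : Gamma) (x : S) : S :=
  ra (la g x) (alpha_cocycle X g x)^-1%g.

(* The right action of [Delta] on the quotient by [Gamma], transported to the
   cross-section [Y] and made into a left action by inversion. *)
Definition Y_action (Y : set S) (e : Delta) (y : S) : S :=
  la (translate_index la Y (ra y e^-1%g))^-1%g (ra y e^-1%g).

End Coupling.

Definition covered (S : Type) (Gamma Delta : groupType)
    (la : Gamma -> S -> S) (ra : S -> Delta -> S) (Y : set S)
    (F : set Delta) (K : set Gamma) (A : set S) : Prop :=
  \bigcup_(e in F) (ra^~ e @` A) `<=` \bigcup_(g in K) (la g @` Y).

Definition calA (R : realType) (d : measure_display) (S : measurableType d)
    (sigma : set S -> \bar R) (Gamma Delta : groupType)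
    (la : Gamma -> S -> S) (ra : S -> Delta -> S) (X Y : set S)
    (F : set Delta) : set (set S) :=
  [set A | [/\ measurable A, A `<=` X, (sigma A < +oo)%E &
               exists2 K : set Gamma, finite_set K & covered la ra Y F K A]].

(* Main.v *)
Require Import Defs.
From HB Require Import structures.
From mathcomp Require Import all_boot all_order all_algebra.
From mathcomp Require Import all_classical all_reals all_analysis.

Set Implicit Arguments.
Unset Strict Implicit.
Unset Printing Implicit Defensive.

Import Order.TTheory GRing.Theory Num.Theory.
Import numFieldNormedType.Exports.

Local Open Scope classical_set_scope.
Local Open Scope ring_scope.

(** Everything rests on one fact: finitely many Borel functions with values in
    a countable set take only finitely many values outside a set of small
    measure, provided that they are defined on a set of finite measure
    ([finite_values_off_small]).  The functions are the indices
    [translate_index] of the two tilings of [S], by the translates of [X] and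
    by those of [Y].

    For the tiling by [X], the functions are [alpha g] for [g] in [K], and the
    fact is condition (i), for the probability measure as well as for [sigma];
    since [la g x] lies in the translate of [X] with index [alpha g x], it is
    also (a).  For the tiling by [Y], the functions send [x] to the index of
    [ra x e], for [e] in [F], and the fact says that most of [A] is [covered]
    by finitely many translates of [Y], which is (b1).

    For (b2) let [x] and [act g x] be in [A] with [alpha g x] in [F].  Then
    [la g x], which is [act g x] moved by [alpha g x], lies in a translate of
    [Y] with index [k] in [K]; and [x], which is [x] moved by the identity of
    [F], lies in one with index [l] in [K].  As [la g x] then has index
    [g * l], disjointness gives [g = k * l^-1].  Condition (ii) follows by
    adjoining the identity to [L] and covering most of [X] for the probability
    measure.

    The remaining parts of properness are that [alpha] is a Borel cocycle,
    because its fibres are preimages of translates of [X] and the two actions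
    commute, and that [act] preserves the class of the probability measure,
    which has the same null sets as the restriction of [sigma] to [X]. *)

(** * Countably valued functions *)

(** The points at which some function has a value of rank at least [n], in an
    enumeration of the values, form a decreasing sequence of sets with empty
    intersection, so their measure tends to zero by continuity from above. *)
Lemma finite_values_off_small (R : realType) (d : measure_display)
    (T : measurableType d) (m : {measure set T -> \bar R}) (I V : Type)
    (K : set I) (f : I -> T -> V) (A : set T) (eps : R) :
  countable [set: V] -> finite_set K -> measurable A -> (m A < +oo)%E ->
  (forall i v, K i -> measurable (A `&` f i @^-1` [set v])) -> 0 < eps ->
  exists A' : set T,
    [/\ measurable A', A' `<=` A, (m (A `\` A') < eps%:E)%E &
        finite_set [set f i x | i in K & x in A']].
Proof.
move=> /countable_injP[r r_inj] finK mA Afin mf eps0.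
pose U n := A `&` [set x | exists2 i, K i & (n <= r (f i x))%N].
have mU n : measurable (U n).
  rewrite (_ : U n = \bigcup_(i in K) \bigcup_v
      (if (n <= r v)%N then A `&` f i @^-1` [set v] else set0)).
    apply: fin_bigcup_measurable => // i Ki.
    apply: countable_bigcupT_measurable.
      by apply/countable_injP; exists r.
    by move=> v; case: ifP => // _; exact: mf.
  apply/seteqP; split=> [x [Ax [i Ki nle]]|x [i Ki [v _]]].
    by exists i => //; exists (f i x) => //; rewrite nle.
  by case: ifP => // nle [Ax fv]; split=> //; exists i => //; rewrite fv.
have U0 : \bigcap_n U n = set0.
  rewrite -subset0 => x Ux.
  have /finite_seqP[B BE] : finite_set [set r (f i x) | i in K].
    exact: finite_image.
  (* The finitely many ranks attained at [x] are bounded by their sum. *)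
  pose M := (\sum_(k <- B) k)%N.
  have [_ [i Ki Mlt]] := Ux M.+1 Logic.I.
  have iB : r (f i x) \in B.
    suff : [set` B] (r (f i x)) by [].
    by rewrite -BE; exists i.
  suff : (r (f i x) <= M)%N by rewrite leqNgt Mlt.
  by rewrite /M (big_rem _ iB) /= leq_addr.
have : m \o U @ \oo --> (0 : \bar R)%E.
  rewrite -(measure0 m) -U0; apply: nonincreasing_cvg_mu => //.
  - by rewrite (le_lt_trans _ Afin)// le_measure ?inE// => x [].
  - by rewrite U0.
  - move=> p q pq; apply/subsetPset => x [Ax [i Ki qle]].
    by split=> //; exists i => //; exact: leq_trans qle.
have nbhs0 : nbhs (0 : \bar R)%E [set y | (y < eps%:E)%E].
  apply: open_nbhs_nbhs; split; first exact: open_ereal_lt_ereal.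
  by rewrite /= lte_fin.
move=> /(_ _ nbhs0)[n _ /(_ n (leqnn n)) mUn]; exists (A `\` U n); split.
- exact: measurableD.
- by move=> x [].
- by rewrite setDD setIC (_ : U n `&` A = U n)//; apply/setIidPl => x [].
apply: (@sub_finite_set _ _ (r @^-1` `I_n)).
  move=> _ [i Ki [x [Ax NU] <-]] /=; rewrite ltnNge; apply/negP => nle.
  by apply: NU; split=> //; exists i.
apply: finite_preimage; last exact: finite_II.
by move=> u v _ _; apply: r_inj; rewrite inE.
Qed.

(** * Tilings by translates *)

Section Tilings.
Context (T : Type) (G : groupType) (tr : G -> T -> T) (D : set T).
Hypothesis tilingD : fundamental_domain tr D.

Lemma translate_indexP (w : T) : (tr (translate_index tr D w) @` D) w.
Proof.
have [_ cov] := tilingD.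
have [g _ gw] : (\bigcup_g (tr g @` D)) w by rewrite cov.
by have := @xgetPex _ 1%g [set g | (tr g @` D) w] (ex_intro _ g gw).
Qed.

Lemma translate_index_unique (g : G) (w : T) :
  (tr g @` D) w -> translate_index tr D w = g.
Proof.
have [triv _] := tilingD.
by move=> gw; apply: triv => //; exists w; split=> //; exact: translate_indexP.
Qed.

Lemma translate_index_fibre (g : G) :
  translate_index tr D @^-1` [set g] = tr g @` D.
Proof.
apply/seteqP; split=> [w <-|w]; first exact: translate_indexP.
exact: translate_index_unique.
Qed.

End Tilings.

Lemma measurable_translate (R : realType) (d : measure_display)
    (T : measurableType d) (m : set T -> \bar R) (G : groupType)
    (tr : G -> T -> T) (g : G) (D : set T) :
  measure_preserving m tr ->
  cancel (tr g) (tr g^-1%g) -> cancel (tr g^-1%g) (tr g) ->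
  measurable D -> measurable (tr g @` D).
Proof.
move=> mtr gK Kg mD; rewrite (_ : _ @` _ = tr g^-1%g @^-1` D).
  by rewrite -[X in measurable X]setTI; exact: (mtr g^-1%g).1.
apply/seteqP; split=> [_ [x Dx <-]|x Dx] /=; first by rewrite gK.
by exists (tr g^-1%g x).
Qed.

(** * The cocycle of a coupling *)

Section Cocycle.
Context (S : Type) (Gamma Delta : groupType).
Variables (la : Gamma -> S -> S) (ra : S -> Delta -> S) (X : set S).
Hypotheses (la_action : is_left_action la) (ra_action : is_right_action ra).
Hypothesis la_ra_commute : forall g e w, ra (la g w) e = la g (ra w e).
Hypothesis X_domain : fundamental_domain (fun e w => ra w e) X.

Let alpha := alpha_cocycle la ra X.
Let act := X_action la ra X.

Lemma laK (g : Gamma) : cancel (la g) (la g^-1%g).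
Proof. by move=> w; rewrite -la_action.2 mulVg la_action.1. Qed.

Lemma laVK (g : Gamma) : cancel (la g^-1%g) (la g).
Proof. by move=> w; rewrite -la_action.2 mulgV la_action.1. Qed.

Lemma raK (e : Delta) : cancel (ra^~ e) (ra^~ e^-1%g).
Proof. by move=> w /=; rewrite -ra_action.2 mulgV ra_action.1. Qed.

Lemma raVK (e : Delta) : cancel (ra^~ e^-1%g) (ra^~ e).
Proof. by move=> w /=; rewrite -ra_action.2 mulVg ra_action.1. Qed.

Lemma X_actionE (g : Gamma) (x : S) : la g x = ra (act g x) (alpha g x).
Proof. by rewrite /act /X_action raVK. Qed.

Lemma X_action_in (g : Gamma) (x : S) : X (act g x).
Proof.
have [y Xy yE] := translate_indexP X_domain (la g x).
by rewrite /act /X_action /alpha_cocycle -[in X in ra X _]yE raK.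
Qed.

Lemma X_action_unique (g : Gamma) (x y : S) (e : Delta) :
  X y -> la g x = ra y e -> alpha g x = e /\ act g x = y.
Proof.
move=> Xy gxE; have aE : alpha g x = e.
  by apply: translate_index_unique => //; exists y.
by split=> //; rewrite /act /X_action -/(alpha g x) aE gxE raK.
Qed.

Lemma alpha_mul (g h : Gamma) (x : S) :
  alpha (g * h)%g x = (alpha g (act h x) * alpha h x)%g.
Proof.
apply: (@X_action_unique _ _ (act g (act h x)) _ (X_action_in _ _) _).1.
rewrite la_action.2 (X_actionE h) -la_ra_commute (X_actionE g).
by rewrite ra_action.2.
Qed.

Lemma X_actionVK (g : Gamma) (y : S) : X y -> act g (act g^-1%g y) = y.
Proof.
move=> Xy; apply: (@X_action_unique _ _ y (alpha g^-1%g y)^-1%g Xy _).2.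
apply: (can_inj (raK (alpha g^-1%g y))) => /=.
by rewrite raVK la_ra_commute -X_actionE laVK.
Qed.

(** A return from [A] to [A] along [F] compares two tiles with indices in
    [K]: that of the point and that of its translate. *)
Lemma recurrence_set_eq0 (Y A : set S) (F : set Delta) (K : set Gamma)
    (g : Gamma) :
  fundamental_domain la Y -> A `<=` X -> F 1%g -> covered la ra Y F K A ->
  ~ [set (k * l^-1)%g | k in K & l in K] g ->
  recurrence_set act alpha A F g = set0.
Proof.
move=> Y_domain AX F1 cov NKK; rewrite -subset0 => x [[Ax [y Ay yE]] Fx].
apply: NKK.
have [l Kl [v Yv vE]] : (\bigcup_(k in K) (la k @` Y)) x.
  by apply: cov; exists 1%g => //; exists x => //; rewrite ra_action.1.
have [k Kk kY] : (\bigcup_(k in K) (la k @` Y)) (la g x).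
  apply: cov; exists (alpha g x) => //; exists y => //.
  by rewrite [RHS]X_actionE -yE X_actionVK ?yE//; exact: AX.
exists k => //; exists l => //.
rewrite -(translate_index_unique Y_domain kY).
rewrite (@translate_index_unique _ _ _ _ Y_domain (g * l)%g) ?mulgK//.
by exists v => //; rewrite la_action.2 vE.
Qed.

End Cocycle.

(** * Properness of the cocycle *)

Theorem lemma3p1 (R : realType) (Gamma Delta : groupType)
    (Gamma_countable : countable [set: Gamma])
    (Delta_countable : countable [set: Delta])
    (d : measure_display) (S : measurableType d)
    (sigma : {sigma_finite_measure set S -> \bar R})
    (S_standard : standard_borel R S)
    (sigma_infinite : sigma setT = +oo%E)
    (la : Gamma -> S -> S) (ra : S -> Delta -> S)
    (la_action : is_left_action la)
    (ra_action : is_right_action ra)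
    (la_ra_commute : forall g e w, ra (la g w) e = la g (ra w e))
    (la_free : free_translations la)
    (ra_free : free_translations (fun e w => ra w e))
    (la_preserving : measure_preserving sigma la)
    (ra_preserving : measure_preserving sigma (fun e w => ra w e))
    (X Y : set S) (mX : measurable X) (mY : measurable Y)
    (X_domain : fundamental_domain (fun e w => ra w e) X)
    (Y_domain : fundamental_domain la Y)
    (X_amenable : amenable_pair X (mrestr sigma mX) (X_action la ra X))
    (Y_amenable : amenable_pair Y (mrestr sigma mY) (Y_action la ra Y)) :
  let mu := mrestr sigma mX in
  let alpha := alpha_cocycle la ra X in
  let act := X_action la ra X in
  (* properness *)
  (forall m : probability S R, m `<< mu -> mu `<< m ->
     proper_cocycle X m act alpha) /\
  (* (a) *)
  (forall (K : set Gamma) (A : set S) (eps : R),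
     K 1%g -> finite_set K -> measurable A -> A `<=` X ->
     (sigma A < +oo)%E -> 0 < eps ->
     exists (A' : set S) (F : set Delta),
       [/\ measurable A' /\ A' `<=` A, finite_set F,
           (sigma (A `\` A') < eps%:E)%E,
           \bigcup_(g in K) (la g @` A') `<=`
             \bigcup_(e in F) (ra^~ e @` X) &
           finite_set (cocycle_values alpha K A')]) /\
  (* (b) *)
  (forall F : set Delta, F 1%g -> finite_set F ->
     (* (b1) *)
     (forall (A : set S) (eps : R),
        measurable A -> A `<=` X -> (sigma A < +oo)%E -> 0 < eps ->
        exists A' : set S,
          [/\ calA sigma la ra X Y F A', A' `<=` A &
              (mu (A `\` A') < eps%:E)%E]) /\
     (* (b2) *)
     (forall (A : set S) (K : set Gamma),
        calA sigma la ra X Y F A -> finite_set K -> covered la ra Y F K A ->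
        forall g : Gamma,
          ~ [set (k * l^-1)%g | k in K & l in K] g ->
          recurrence_set act alpha A F g = set0)).
Proof.
move=> mu alpha act.
have mXt e : measurable (ra^~ e @` X).
  exact: (measurable_translate ra_preserving (raK _ _) (raVK _ _)).
have mYt g : measurable (la g @` Y).
  exact: (measurable_translate la_preserving (laK _ _) (laVK _ _)).
have malpha g e : measurable (alpha g @^-1` [set e]).
  rewrite (_ : _ @^-1` _ = la g @^-1` (ra^~ e @` X)).
    by rewrite -[X in measurable X]setTI; exact: (la_preserving g).1.
  by rewrite -(translate_index_fibre X_domain).
pose beta e x := translate_index la Y (ra x e).
have mbeta e g : measurable (beta e @^-1` [set g]).
  rewrite (_ : _ @^-1` _ = ra^~ e @^-1` (la g @` Y)).
    by rewrite -[X in measurable X]setTI; exact: (ra_preserving e).1.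
  by rewrite -(translate_index_fibre Y_domain).
have small_alpha (m : {measure set S -> \bar R}) (K : set Gamma) (A : set S)
    (eps : R) : finite_set K -> measurable A -> (m A < +oo)%E -> 0 < eps ->
    exists A', [/\ measurable A', A' `<=` A, (m (A `\` A') < eps%:E)%E &
        finite_set (cocycle_values alpha K A')].
  move=> finK mA Afin eps0; apply: finite_values_off_small => // g e _.
  exact: measurableI.
have small_covered (m : {measure set S -> \bar R}) (F : set Delta) (A : set S)
    (eps : R) : finite_set F -> measurable A -> (m A < +oo)%E -> 0 < eps ->
    exists A', [/\ measurable A', A' `<=` A, (m (A `\` A') < eps%:E)%E &
        exists2 K, finite_set K & covered la ra Y F K A'].
  move=> finF mA Afin eps0.
  have [|A' [mA' A'A small finK]] := @finite_values_off_small _ _ _ m _ _ F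
      beta A eps Gamma_countable finF mA Afin _ eps0.
    by move=> e g _; exact: measurableI.
  exists A'; split => //; eexists; first exact: finK.
  move=> _ [e Fe [x A'x <-]]; exists (beta e x).
    by exists e => //; exists x.
  exact: translate_indexP.
have muE B : B `<=` X -> mu B = sigma B.
  by move=> BX; rewrite /mu /mrestr (setIidl BX).
split; [|split].
- move=> m m_mu mu_m.
  have m_fin B : measurable B -> (m B < +oo)%E.
    by move=> mB; rewrite (le_lt_trans (probability_le1 m mB))// ltry.
  have m_real : fin_num_fun m by move=> B mB; exact: fin_num_measure.
  have m0 B : measurable B -> m B = 0%E <-> mu B = 0%E.
    move=> mB; split=> B0.
      exact: (proj1 (null_content_dominatesP _ _) mu_m).
    exact: (proj1 (null_content_dominatesP _ _) m_mu).
  have [_ [actX act1 actM mact act0] _] := X_amenable.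
  split.
  + split=> //; last first.
      by apply: fin_num_fun_sigma_finite m_real; rewrite measure0.
    apply/m0; first exact: measurableC.
    by rewrite /mu /mrestr setICl measure0.
  + split=> // g A mA AX; rewrite m0 ?m0//; last exact: mact.
    exact: act0.
  + split=> [g B|g h x _]; last exact: alpha_mul.
    rewrite (_ : _ `&` _ = \bigcup_e
        (if `[< B e >] then X `&` alpha g @^-1` [set e] else set0)).
      apply: countable_bigcupT_measurable => // e.
      by case: ifP => // _; exact: measurableI.
    apply/seteqP; split=> [x [Xx Bx]|x [e _]].
      by exists (alpha g x) => //; rewrite (asboolT Bx).
    by case: asboolP => // Be [Xx xe]; split=> //; rewrite /preimage /= xe.
  + move=> A eps K mA AX eps0 finK.
    exact: small_alpha (m_fin _ mA) eps0.
  + move=> L eps finL eps0.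
    (* The finite measure allows covering most of the whole of [X]. *)
    have [|A [mA AX small [K finK cov]]] := small_covered m (1%g |` L) X eps _
        mX (m_fin _ mX) eps0; first by rewrite finite_setU.
    exists A; split=> //; first exact: ltW.
    have finKK : finite_set [set (k * l^-1)%g | k in K & l in K].
      exact: finite_image2.
    apply: sub_finite_set finKK => g /=; apply: contraPP => NKK; apply/negP.
    rewrite -leNgt.
    rewrite (_ : recurrence_set _ _ _ _ _ = set0) ?measure0//.
    rewrite -subset0 => x [xA Lx].
    rewrite -(recurrence_set_eq0 la_action ra_action la_ra_commute X_domain
      Y_domain AX (or_introl erefl : (1%g |` L) 1%g) cov NKK).
    by split=> //; right.
- move=> K A eps _ finK mA AX Afin eps0.
  have [A' [mA' A'A small finF]] := small_alpha sigma K A eps finK mA Afin eps0.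
  exists A', (cocycle_values alpha K A'); split=> //.
  move=> _ [g Kg [x A'x <-]]; exists (alpha g x).
    by exists g => //; exists x.
  exists (act g x); first exact: (X_action_in la ra_action X_domain).
  by rewrite -(X_actionE la X ra_action).
- move=> F F1 finF; split.
  + move=> A eps mA AX Afin eps0.
    have [A' [mA' A'A small cov]] :=
      small_covered sigma F A eps finF mA Afin eps0.
    exists A'; split=> //; last by rewrite muE// => x [/AX].
    split=> //; first exact: subset_trans AX.
    by rewrite (le_lt_trans _ Afin)// le_measure ?inE.
  + move=> A K [_ AX _ _] _ cov g NKK.
    exact: (recurrence_set_eq0 la_action ra_action la_ra_commute X_domain
      Y_domain AX F1 cov NKK).
Qed.
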